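(* For binary strings $s,t\in\{0,1\}^n$, let $\mathrm{LCS}(s,t)$ denote the length of a longest common subsequence of $s$ and $t$. Let $s$ and $t$ be drawn independently and uniformly at random from $\{0,1\}^n$. Then \[ \mathbb{E}\big[\mathrm{LCS}(s,t)\big] \ge 0.66666\,n - O\big(\sqrt{n\log n}\big) \] as $n\to\infty$.
   Context: A string $u=u_1\cdots u_m$ is a subsequence of $t=t_1\cdots t_n$ if there are indices $i_1<\dots<i_m$ with $u_j=t_{i_j}$ for all $j$. A longest common subsequence of $s$ and $t$ is a longest string that is a subsequence of both. *)

(* Defs.v *)
From HB Require Import structures.
From mathcomp Require Import all_boot all_order all_algebra.
From mathcomp Require Import all_classical all_reals all_analysis.

Set Implicit Arguments.
Unset Strict Implicit.
Unset Printing Implicit Defensive.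

Import Order.TTheory GRing.Theory Num.Theory.

(* Every common subsequence of [s] and [t] has length at most [size s], so the
   bounded maximum ranges over all possible lengths (see [leq_lcs]). *)
Definition lcs (T : finType) (s t : seq T) : nat :=
  \max_(m < (size s).+1 | [exists u : m.-tuple T, subseq u s && subseq u t]) m.

Lemma leq_lcs (T : finType) (s t u : seq T) :
  subseq u s -> subseq u t -> size u <= lcs s t.
Proof.
move=> us ut; have lt_us : size u < (size s).+1 by rewrite ltnS size_subseq.
apply: (@leq_bigmax_cond _ _ (fun m : 'I__ => m : nat) (Ordinal lt_us)).
by apply/existsP; exists (in_tuple u); rewrite us.
Qed.

Lemma lcs_attained (T : finType) (s t : seq T) :
  exists u : seq T, [/\ subseq u s, subseq u t & size u = lcs s t].
Proof.
rewrite /lcs; elim/big_ind: _ => [|x y [u Hu] [v Hv]|m /existsP[u /andP[us ut]]].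
- by exists [::]; rewrite !sub0seq.
- by rewrite /maxn; case: ifP => _; [exists v | exists u].
- by exists u; rewrite us ut size_tuple.
Qed.

Local Open Scope ring_scope.

Definition uniform_pmf (R : realType) (T : finType) (x : T) : R := #|T|%:R^-1.

(* Independence: the joint law of the pair is the product of the two laws. *)
Definition expected_lcs (R : realType) (n : nat) : R :=
  \sum_(s : n.-tuple bool) \sum_(t : n.-tuple bool)
    uniform_pmf R s * uniform_pmf R t * (lcs s t)%:R.

(* Main.v *)
Require Import Defs.
From Stdlib Require Import BinNat Nnat.
From mathcomp Require Import all_boot all_order all_algebra.
From mathcomp Require Import all_classical all_reals all_analysis.
From mathcomp Require Import lra.
Import Order.TTheory GRing.Theory Num.Theory.
Import numFieldNormedType.Exports.
Local Open Scope classical_set_scope.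
Local Open Scope ring_scope.

(** Concatenating common subsequences shows that [lcs], and hence its expectation
    [e n], is superadditive. So [e n >= (n %/ 7) * e 7], and it suffices to find a
    block length [k] with [e k / k > 0.66666]; [k = 7] is the least one, since
    the [4 ^ 7] pairs of words have total LCS length 77356, and
    [77356 / (7 * 4 ^ 7) = 0.674...]. The error term is then even bounded. *)

Lemma leq_lcs_cat (T : finType) (s1 s2 t1 t2 : seq T) :
  (lcs s1 t1 + lcs s2 t2 <= lcs (s1 ++ s2) (t1 ++ t2))%N.
Proof.
have [u1 [us1 ut1 <-]] := lcs_attained s1 t1.
have [u2 [us2 ut2 <-]] := lcs_attained s2 t2.
by rewrite -size_cat; apply: leq_lcs; apply: cat_subseq.
Qed.

Lemma lcs_subseq (T : finType) (s s' t t' : seq T) :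
  subseq s s' -> subseq t t' -> (lcs s t <= lcs s' t')%N.
Proof.
move=> ss' tt'; have [u [us ut <-]] := lcs_attained s t.
by apply: leq_lcs; [apply: subseq_trans ss' | apply: subseq_trans tt'].
Qed.

Lemma lcs_cons (T : finType) (x : T) (s t : seq T) :
  (lcs s t < lcs (x :: s) (x :: t))%N.
Proof.
have [u [us ut <-]] := lcs_attained s t.
by apply: (@leq_lcs _ _ _ (x :: u)); rewrite /= eqxx.
Qed.

(** The usual recursion for the LCS length, in a form that evaluates, unlike the maximum over tuples
    in [lcs]. The inner [fix] handles the calls that shorten only [t]. *)
Fixpoint greedy_lcs (T : eqType) (s : seq T) : seq T -> nat :=
  if s is x :: s' then
    fix aux (t : seq T) : nat :=
      if t is y :: t' then
        if x == y then (greedy_lcs T s' t').+1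
        else maxn (greedy_lcs T s' t) (aux t')
      else 0
  else fun=> 0.

(** Equal heads extend a common subsequence of the tails; otherwise, dropping the head of either
    word cannot increase [lcs]. *)
Lemma greedy_lcs_le (T : finType) (s t : seq T) :
  (greedy_lcs T s t <= lcs s t)%N.
Proof.
elim: s t => [|x s IHs] //; elim=> [|y t IHt] //=.
case: eqVneq => [<-|_]; first exact: leq_ltn_trans (IHs t) (lcs_cons _ _ _ _).
rewrite geq_max (leq_trans (IHs _)) ?(leq_trans IHt) //.
- by apply: lcs_subseq => //; apply: subseq_cons.
- by apply: lcs_subseq => //; apply: subseq_cons.
Qed.

Lemma sum_tuple0 (T : finType) (F : seq T -> nat) :
  (\sum_(s : 0.-tuple T) F s = F [::])%N.
Proof.
rewrite (bigD1 [tuple]) //= big1 ?addn0 // => s /negP[].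
by apply/eqP; rewrite [s]tuple0.
Qed.

Lemma sum_tupleS (T : finType) (n : nat) (F : seq T -> nat) :
  (\sum_(s : n.+1.-tuple T) F s = \sum_(x : T) \sum_(s : n.-tuple T) F (x :: s))%N.
Proof.
rewrite pair_big /=.
rewrite (reindex (fun p : T * n.-tuple T => [tuple of p.1 :: p.2])) //=.
exists (fun s : n.+1.-tuple T => (thead s, [tuple of behead s])) => [[x s] _|s _].
- by congr pair; apply: val_inj.
- by rewrite -tuple_eta.
Qed.

Lemma sum_tuple_cat (T : finType) (m n : nat) (F : seq T -> nat) :
  (\sum_(s : (m + n).-tuple T) F s =
   \sum_(u : m.-tuple T) \sum_(v : n.-tuple T) F (u ++ v))%N.
Proof.
elim: m F => [|m IHm] F.
  by rewrite (sum_tuple0 _ (fun u => \sum_(v : n.-tuple T) F (u ++ v))%N).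
rewrite (sum_tupleS _ (m + n)%N).
rewrite (sum_tupleS _ _ (fun u => \sum_(v : n.-tuple T) F (u ++ v))%N).
by apply: eq_bigr => x _; rewrite (IHm (fun s => F (x :: s))).
Qed.

(** This is [4 ^ n] times the expectation, so that the counting takes place in the naturals. *)
Definition lcs_sum (n : nat) : nat :=
  (\sum_(s : n.-tuple bool) \sum_(t : n.-tuple bool) lcs s t)%N.

(** Cut both words after [m] letters: each pair of prefixes meets [4 ^ n] pairs of suffixes, and
    each pair of suffixes meets [4 ^ m] pairs of prefixes. *)
Lemma lcs_sum_superadd (m n : nat) :
  (4 ^ n * lcs_sum m + 4 ^ m * lcs_sum n <= lcs_sum (m + n))%N.
Proof.
have const_sum k c : (\sum_(s : k.-tuple bool) c = 2 ^ k * c)%N.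
  by rewrite sum_nat_const card_tuple card_bool.
rewrite {3}/lcs_sum.
rewrite (sum_tuple_cat _ _ _ (fun s => \sum_(t : (m + n).-tuple bool) lcs s t)%N).
pose G := (\sum_(s1 : m.-tuple bool) \sum_(s2 : n.-tuple bool)
  \sum_(t1 : m.-tuple bool) \sum_(t2 : n.-tuple bool) (lcs s1 t1 + lcs s2 t2))%N.
apply: (@leq_trans G); last first.
  apply: leq_sum => s1 _; apply: leq_sum => s2 _.
  rewrite (sum_tuple_cat _ _ _ (fun t => lcs (s1 ++ s2) t)).
  by apply: leq_sum => t1 _; apply: leq_sum => t2 _; apply: leq_lcs_cat.
(* Summing over the two halves of [t] yields the factors [2 ^ n] and [2 ^ m]; the sums over [s2] and
   then [s1] square them. *)
have HG : G = (\sum_(s1 : m.-tuple bool) \sum_(s2 : n.-tuple bool)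
    (2 ^ n * (\sum_(t1 : m.-tuple bool) lcs s1 t1) +
     2 ^ m * (\sum_(t2 : n.-tuple bool) lcs s2 t2)))%N.
  apply: eq_bigr => s1 _; apply: eq_bigr => s2 _.
  rewrite big_distrr /= -(const_sum m) -big_split /=.
  by apply: eq_bigr => t1 _; rewrite big_split /= const_sum.
have -> : G = (\sum_(s1 : m.-tuple bool)
    (4 ^ n * (\sum_(t1 : m.-tuple bool) lcs s1 t1) + 2 ^ m * lcs_sum n))%N.
  rewrite HG; apply: eq_bigr => s1 _.
  by rewrite big_split /= const_sum -big_distrr /= mulnA -expnMn.
by rewrite big_split /= const_sum -big_distrr /= mulnA -expnMn.
Qed.

(* Binary naturals keep the evaluation of the sum over pairs of words feasible. *)
Fixpoint sum_words (n : nat) (F : seq bool -> N) : N :=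
  if n is n'.+1 then
    (sum_words n' (fun s => F (true :: s)) + sum_words n' (fun s => F (false :: s)))%num
  else F [::].

Lemma sum_wordsE (n : nat) (F : seq bool -> N) :
  N.to_nat (sum_words n F) = (\sum_(s : n.-tuple bool) N.to_nat (F s))%N.
Proof.
elim: n F => [|n IHn] F /=; first by rewrite (sum_tuple0 _ (fun s => N.to_nat (F s))).
by rewrite N2Nat.inj_add !IHn (sum_tupleS _ _ (fun s => N.to_nat (F s))) big_bool.
Qed.

Definition greedy_sum (n : nat) : N :=
  sum_words n (fun s => sum_words n (fun t => N.of_nat (greedy_lcs bool s t))).

Lemma greedy_sum_le (n : nat) : (N.to_nat (greedy_sum n) <= lcs_sum n)%N.
Proof.
rewrite sum_wordsE; apply: leq_sum => s _; rewrite sum_wordsE.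
by apply: leq_sum => t _; rewrite Nat2N.id greedy_lcs_le.
Qed.

(** The total 77356 is written in the shape [a * b + c] used by [leq_mul_to_nat]. *)
Lemma greedy_sum7 : greedy_sum 7 = (773 * 100 + 56)%num.
Proof. by vm_compute. Qed.

(** With variables in place of numerals, the conversion to [nat] stays symbolic. *)
Lemma leq_mul_to_nat (a b c : N) :
  (N.to_nat a * N.to_nat b <= N.to_nat (a * b + c)%num)%N.
Proof. by rewrite N2Nat.inj_add N2Nat.inj_mul; exact: leq_addr. Qed.

(* The bound is kept factored so that no large unary numeral is ever computed. *)
Lemma lcs_sum7_ge : (773 * 100 <= lcs_sum 7)%N.
Proof.
have := leq_mul_to_nat 773 100 56.
have -> : N.to_nat 773 = 773%N by [].
have -> : N.to_nat 100 = 100%N by [].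
rewrite -greedy_sum7 => /leq_trans; apply.
exact: greedy_sum_le.
Qed.

Lemma expected_lcsE (R : realType) (n : nat) :
  expected_lcs R n = (lcs_sum n)%:R / 4 ^+ n.
Proof.
rewrite /expected_lcs /lcs_sum natr_sum mulr_suml.
apply: eq_bigr => s _; rewrite natr_sum mulr_suml; apply: eq_bigr => t _.
rewrite mulrC /uniform_pmf card_tuple card_bool natrX -invfM -exprMn.
by rewrite -natrM.
Qed.

Lemma expected_lcs_superadd (R : realType) (m n : nat) :
  expected_lcs R m + expected_lcs R n <= expected_lcs R (m + n).
Proof.
have pow4_gt0 k : 0 < (4 : R) ^+ k by rewrite exprn_gt0.
have pow4_neq0 k : (4 : R) ^+ k != 0 by rewrite gt_eqF.
rewrite !expected_lcsE addf_div // -exprD ler_pM2r ?invr_gt0 //.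
by rewrite -!natrX -!natrM -natrD ler_nat mulnC [X in (_ + X)%N]mulnC lcs_sum_superadd.
Qed.

Lemma expected_lcs7_ge (R : realType) : (66 * 10 ^+ 3 + 666) / 10 ^+ 5 * 7 <= expected_lcs R 7.
Proof.
rewrite expected_lcsE ler_pdivlMr ?exprn_gt0 //.
(* Rounding 77356 down to 77300 is harmless: [0.66666 * 7 * 4 ^ 7] is below 76458. *)
apply: le_trans (_ : (773 * 100)%:R <= _); last by rewrite ler_nat lcs_sum7_ge.
by rewrite natrM; lra.
Qed.

(** Blocks of length 7 are split off one at a time; the constant 5 is paid only once, for the
    remainder of length below 7. *)
Lemma expected_lcs_ge (R : realType) (n : nat) :
  (66 * 10 ^+ 3 + 666) / 10 ^+ 5 * n%:R - 5 <= expected_lcs R n.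
Proof.
elim/ltn_ind: n => n IHn; have [n_lt7|n_ge7] := ltnP n 7.
  (* At most 6 letters give a linear term below 4, so the left side is negative. *)
  apply: (@le_trans _ _ 0); last by rewrite expected_lcsE divr_ge0 ?exprn_ge0.
  by have : n%:R <= 6 :> R; [rewrite ler_nat | lra].
rewrite -(subnKC n_ge7); apply: le_trans (expected_lcs_superadd _ _ _).
have := IHn (n - 7)%N; rewrite ltn_subrL (leq_trans _ n_ge7) // => /(_ isT).
by rewrite natrD; have := expected_lcs7_ge R; lra.
Qed.

Theorem theorem5p2 (R : realType) :
  exists2 err : nat -> R,
    err =O_\oo (fun n : nat => Num.sqrt (n%:R * ln n%:R)) &
    forall n : nat, (66 * 10 ^+ 3 + 666) / 10 ^+ 5 * n%:R - err n <= expected_lcs R n.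
Proof.
exists (fun=> 5); last exact: expected_lcs_ge.
apply/eqOP; near=> k; near=> n.
(* Once [n] is at least e, both [n] and [ln n] are at least 1, hence so is the square root, and any
   [k >= 5] serves as the implied constant. *)
have n_gee : expR 1 <= n%:R :> R by near: n; exact: nbhs_infty_ger.
have n_ge1 : 1 <= n%:R :> R by apply: le_trans n_gee; rewrite -expR0 ler_expR.
have ln_ge1 : 1 <= ln n%:R :> R.
  by rewrite -ler_expR lnK // posrE (lt_le_trans ltr01).
have sqrt_ge1 : 1 <= Num.sqrt (n%:R * ln n%:R) :> R.
  by rewrite -[leLHS]sqrtr1 ler_wsqrtr // mulr_ege1.
rewrite !ger0_norm ?sqrtr_ge0 //.
have k_ge5 : 5 <= k by near: k; apply: nbhs_pinfty_ge; rewrite realn.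
by rewrite -[5]mulr1 ler_pM.
Unshelve. all: by end_near. Qed.
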